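(* Let $K$ be a field and let $k\geq 1$ be an integer. If $\operatorname{char}K\neq 2,3$, then the algebras $E\otimes\underbrace{E_2\otimes\cdots\otimes E_2}_{k}$ and $E\otimes\underbrace{E_3\otimes\cdots\otimes E_3}_{k}$ satisfy the identity $[x_1,\dots,x_{2k+3}]=0$. Moreover, if $\operatorname{char}K\neq 2$, then $E\otimes\underbrace{E_2\otimes\cdots\otimes E_2}_{k}$ and $E\otimes\underbrace{E_3\otimes\cdots\otimes E_3}_{k}$ do not satisfy the identity $[x_1,\dots,x_{2k+2}]=0$.
   Context: $E$ denotes the (unital) Grassmann (exterior) algebra over a $K$-vector space of countably infinite dimension, and $E_r$ ($r\ge2$) the Grassmann algebra over an $r$-dimensional $K$-vector space. $\otimes=\otimes_K$ is the ordinary (ungraded) tensor product of algebras. Long commutators are left-normed: $[u_1,u_2]=u_1u_2-u_2u_1$ and $[u_1,\dots,u_{m+1}]=[[u_1,\dots,u_m],u_{m+1}]$ for $m\ge 2$. An algebra satisfies an identity if the identity holds for all substitutions of algebra elements for the variables. *)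

(* Defs.v *)
From HB Require Import structures.
From mathcomp Require Import all_boot all_order all_algebra.
From mathcomp Require Import boolp classical_sets.
From mathcomp Require Import finmap monalg.

Set Implicit Arguments.
Unset Strict Implicit.
Unset Printing Implicit Defensive.

Import GRing.Theory.
Import Quotient.

Local Open Scope ring_scope.
Local Open Scope quotient_scope.

Section IdealQuotient.
Variables (K : fieldType) (A : algType K).

Inductive ideal_gen (R : A -> Prop) : A -> Prop :=
| Ideal0 : ideal_gen R 0
| IdealD u v : ideal_gen R u -> ideal_gen R v -> ideal_gen R (u + v)
| IdealM a r b : R r -> ideal_gen R (a * r * b).

Variable R : A -> Prop.

Lemma ideal_genMl a u : ideal_gen R u -> ideal_gen R (a * u).
Proof.
elim=> [|v w _ IHv _ IHw|b r c Rr].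
- by rewrite mulr0; exact: Ideal0.
- by rewrite mulrDr; exact: IdealD.
- by rewrite !mulrA; exact: IdealM.
Qed.

Lemma ideal_genMr a u : ideal_gen R u -> ideal_gen R (u * a).
Proof.
elim=> [|v w _ IHv _ IHw|b r c Rr].
- by rewrite mul0r; exact: Ideal0.
- by rewrite mulrDl; exact: IdealD.
- by rewrite -mulrA; exact: IdealM.
Qed.

Lemma ideal_genZ c u : ideal_gen R u -> ideal_gen R (c *: u).
Proof. by move=> Ru; rewrite -mulr_algl; exact: ideal_genMl. Qed.

Lemma ideal_gen_functional (S : A -> Prop) (phi : A -> K) :
    (forall P : A -> Prop, P 0 -> (forall u v, P u -> P v -> P (u + v)) ->
      (forall c s, S s -> P (c *: s)) -> forall u, P u) ->
    {morph phi : u v / u + v} -> (forall c u, phi (c *: u) = c * phi u) ->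
    (forall s r t, S s -> R r -> S t -> phi (s * r * t) = 0) ->
  forall u, ideal_gen R u -> phi u = 0.
Proof.
move=> Sind phiD phiZ phiR.
have phi0 : phi 0 = 0 by rewrite -(scale0r 0) phiZ mul0r.
move=> u; elim=> [//|v w _ IHv _ IHw|a r b Rr].
  by rewrite phiD IHv IHw addr0.
elim/Sind: a => [|v w IHv IHw|c s Ss].
- by rewrite !mul0r.
- by rewrite !mulrDl phiD IHv IHw addr0.
rewrite -!scalerAl phiZ.
elim/Sind: b => [|v w IHv IHw|d t St].
- by rewrite mulr0 phi0 mulr0.
- by rewrite mulrDr phiD mulrDr IHv IHw addr0.
by rewrite -scalerAr phiZ phiR // !mulr0.
Qed.

Lemma mulrBlr (s t u v : A) : s * (u - v) * t = s * u * t - s * v * t.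
Proof. by rewrite mulrBr mulrBl. Qed.

Lemma mulrDlr (s t u v : A) : s * (u + v) * t = s * u * t + s * v * t.
Proof. by rewrite mulrDr mulrDl. Qed.

Lemma mulrZlr c (s t u : A) : s * (c *: u) * t = c *: (s * u * t).
Proof. by rewrite -scalerAr -scalerAl. Qed.

Definition ideal_pred : pred A := fun u => `[< ideal_gen R u >].

Lemma ideal_predE u : (u \in ideal_pred) = `[< ideal_gen R u >].
Proof. by []. Qed.

Lemma ideal_pred_zmod_closed : zmod_closed ideal_pred.
Proof.
split; first by apply/asboolP; exact: Ideal0.
move=> u v /asboolP Ru /asboolP Rv; apply/asboolP/IdealD => //.
by rewrite -scaleN1r; exact: ideal_genZ.
Qed.

HB.instance Definition _ := GRing.isZmodClosed.Build A ideal_pred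
  ideal_pred_zmod_closed.

Definition ideal_closed : zmodClosed A := GRing.ZmodClosed.clone A ideal_pred _.

(* [algType] requires 1 != 0, so the quotient carries a proof that the ideal is
   proper. *)
Definition alg_quot of ~ ideal_gen R 1 := quot ideal_closed.

Hypothesis R1 : ~ ideal_gen R 1.
Local Notation Q := (alg_quot R1).

HB.instance Definition _ := GRing.Zmodule.on Q.
HB.instance Definition _ := Quotient.on Q.

Definition alg_quot_pi (u : A) : Q := \pi_Q u.
Local Notation "\p u" := (alg_quot_pi u) (at level 10).

Lemma alg_quot_pi_eq u v : (\p u = \p v) <-> ideal_gen R (u - v).
Proof.
have := idealrBE ideal_closed u v; rewrite ideal_predE => E.
by split=> [/eqP|/asboolP]; [rewrite -E => /asboolP | rewrite E => /eqP].
Qed.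

Lemma alg_quot_piD u v : \p (u + v) = \p u + \p v.
Proof.
exact: (@pi_addr A (equiv ideal_closed) 0 -%R +%R (quot ideal_closed)).
Qed.

Lemma alg_quot_ind (P : Q -> Prop) : (forall u, P (\p u)) -> forall x, P x.
Proof. by move=> Pp x; have := Pp (repr x); rewrite /alg_quot_pi reprK. Qed.

Lemma alg_quot_repr u : ideal_gen R (repr (\p u) - u).
Proof. by apply/alg_quot_pi_eq; rewrite /alg_quot_pi reprK. Qed.

Definition alg_quot_mul (x y : Q) : Q := \p (repr x * repr y).
Definition alg_quot_scale (c : K) (x : Q) : Q := \p (c *: repr x).

Lemma alg_quot_piM u v : alg_quot_mul (\p u) (\p v) = \p (u * v).
Proof.
apply/alg_quot_pi_eq; rewrite -(subrKA (u * repr (\p v))) -mulrBl -mulrBr.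
apply: IdealD; first by apply: ideal_genMr; exact: alg_quot_repr.
by apply: ideal_genMl; exact: alg_quot_repr.
Qed.

Lemma alg_quot_piZ c u : alg_quot_scale c (\p u) = \p (c *: u).
Proof.
by apply/alg_quot_pi_eq; rewrite -scalerBr; apply/ideal_genZ/alg_quot_repr.
Qed.

Let mulA : associative alg_quot_mul.
Proof.
by do 3!elim/alg_quot_ind=> ?; rewrite !alg_quot_piM mulrA.
Qed.
Let mul1 : left_id (\p 1) alg_quot_mul.
Proof. by elim/alg_quot_ind=> u; rewrite alg_quot_piM mul1r. Qed.
Let mulr1' : right_id (\p 1) alg_quot_mul.
Proof. by elim/alg_quot_ind=> u; rewrite alg_quot_piM mulr1. Qed.
Let mulDl : left_distributive alg_quot_mul +%R.
Proof.
by do 3!elim/alg_quot_ind=> ?; rewrite !(alg_quot_piM, =^~ alg_quot_piD) mulrDl.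
Qed.
Let mulDr : right_distributive alg_quot_mul +%R.
Proof.
by do 3!elim/alg_quot_ind=> ?; rewrite !(alg_quot_piM, =^~ alg_quot_piD) mulrDr.
Qed.
Let one_neq0 : \p 1 != 0.
Proof.
have p0 : \p 0 = 0 by apply: (addrI (\p 0)); rewrite -alg_quot_piD !addr0.
by apply/eqP; rewrite -p0 alg_quot_pi_eq subr0.
Qed.

HB.instance Definition _ := GRing.Zmodule_isNzRing.Build Q
  mulA mul1 mulr1' mulDl mulDr one_neq0.

Let scaleA a b x :
  alg_quot_scale a (alg_quot_scale b x) = alg_quot_scale (a * b) x.
Proof. by elim/alg_quot_ind: x => u; rewrite !alg_quot_piZ scalerA. Qed.
Let scale1 : left_id 1 alg_quot_scale.
Proof. by elim/alg_quot_ind=> u; rewrite alg_quot_piZ scale1r. Qed.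
Let scaleDr : right_distributive alg_quot_scale +%R.
Proof.
move=> c; do 2!elim/alg_quot_ind=> ?.
by rewrite !(alg_quot_piZ, =^~ alg_quot_piD) scalerDr.
Qed.
Let scaleDl x : {morph alg_quot_scale^~ x : a b / a + b}.
Proof.
elim/alg_quot_ind: x => u a b.
by rewrite !(alg_quot_piZ, =^~ alg_quot_piD) scalerDl.
Qed.

HB.instance Definition _ := GRing.Zmodule_isLmodule.Build K Q
  scaleA scale1 scaleDr scaleDl.

Let scaleAl c (x y : Q) : c *: (x * y) = (c *: x) * y.
Proof.
elim/alg_quot_ind: x => u; elim/alg_quot_ind: y => v.
rewrite /GRing.scale /GRing.mul /=.
by rewrite !(alg_quot_piM, alg_quot_piZ) scalerAl.
Qed.
HB.instance Definition _ := GRing.Lmodule_isLalgebra.Build K Q scaleAl.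

Let scaleAr c (x y : Q) : c *: (x * y) = x * (c *: y).
Proof.
elim/alg_quot_ind: x => u; elim/alg_quot_ind: y => v.
rewrite /GRing.scale /GRing.mul /=.
by rewrite !(alg_quot_piM, alg_quot_piZ) scalerAr.
Qed.
HB.instance Definition _ := GRing.Lalgebra_isAlgebra.Build K Q scaleAr.

End IdealQuotient.

Section MonoidAlgebra.
Variables (K : fieldType) (M : monomType).

Lemma malgUZ (c d : K) (m : M) : << c * d *g m >> = c *: << d *g m >>.
Proof. by apply/malgP => l; rewrite mcoeffZ 2!mcoeffU mulrnAr. Qed.

Lemma malg_scalerAr c (u v : {malg K[M]}) : c *: (u * v) = u * (c *: v).
Proof.
rewrite (malgMEw (fsubset_refl _) (msuppZ_le c v)) malgME scaler_sumr.
apply: eq_bigr => k _; rewrite scaler_sumr; apply: eq_bigr => l _.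
by rewrite mcoeffZ -malgUZ mulrCA.
Qed.

Lemma malg_functional (h : M -> K) : exists phi : {malg K[M]} -> K,
  [/\ {morph phi : u v / u + v}, forall c u, phi (c *: u) = c * phi u
    & forall m, phi << m >> = h m].
Proof.
pose phi : {malg K[M]} -> K := mmap idfun h.
have phiD : {morph phi : u v / u + v} by exact: mmapD.
have phi0 : phi 0 = 0 by exact: mmap0.
have phiU c m : phi << c *g m >> = c * h m by exact: mmapU.
clearbody phi; exists phi; split=> [//|c u|m]; last by rewrite phiU mul1r.
rewrite [u]monalgE scaler_sumr !(big_morph phi phiD phi0) mulr_sumr.
by apply: eq_bigr => m _; rewrite -malgUZ !phiU mulrA.
Qed.

End MonoidAlgebra.

Section FreeAlgebra.
Variables (K : fieldType) (X : choiceType).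

Definition free_alg := {malg K[{fmonom X}]}.

HB.instance Definition _ := GRing.Lalgebra.on free_alg.

HB.instance Definition _ := GRing.Lalgebra_isAlgebra.Build K free_alg
  (@malg_scalerAr K {fmonom X}).

Definition fgen (x : X) : free_alg := << fmu x >>.

Lemma free_alg_ind (P : free_alg -> Prop) :
    P 0 -> (forall u v, P u -> P v -> P (u + v)) ->
    (forall c (m : {fmonom X}), P (c *: (<< m >> : free_alg))) ->
  forall u, P u.
Proof.
move=> P0 PD PZ u; rewrite [u]monalgE; apply: (big_ind P) => // m _.
by rewrite -[mcoeff m u]mulr1 malgUZ; exact: PZ.
Qed.

End FreeAlgebra.

Arguments free_alg : clear implicits.
Arguments fgen K {X} x.

Section Grassmann.
Variables (K : fieldType) (V : lmodType K).
Local Notation "\e v" := (fgen K (v : V)) (at level 10, v at level 9).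

Inductive grassmann_rel : free_alg K V -> Prop :=
| GrassmannD v w : grassmann_rel (\e (v + w) - (\e v + \e w))
| GrassmannZ c v : grassmann_rel (\e (c *: v) - c *: \e v)
| GrassmannSq v : grassmann_rel (\e v * \e v).

Lemma grassmann_proper : ~ ideal_gen grassmann_rel 1.
Proof.
pose aug (u : free_alg K V) : K := @mcoeff {fmonom V} K mone u.
have augD u v : aug (u + v) = aug u + aug v by exact: mcoeffD.
have augB u v : aug (u - v) = aug u - aug v by exact: mcoeffB.
have augZ c u : aug (c *: u) = c * aug u by exact: mcoeffZ.
have augM u v : aug (u * v) = aug u * aug v.
  exact: (rmorphM (@mcoeff {fmonom V} K mone)).
have aug0 : aug 0 = 0 by exact: mcoeff0.
have augE v : aug (\e v) = 0 by rewrite /aug mcoeffU1 -val_eqE /= fmuE fm1.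
suff H u : ideal_gen grassmann_rel u -> aug u = 0.
  by move=> /H/eqP; rewrite /aug mcoeff1 eqxx oner_eq0.
elim=> [//|v w _ IHv _ IHw|a r b Rr]; first by rewrite augD IHv IHw addr0.
suff r0 : aug r = 0 by rewrite !augM r0 mulr0 mul0r.
case: Rr => [v w|c v|v].
- by rewrite augB augD !augE addr0 subr0.
- by rewrite augB augZ !augE mulr0 subr0.
- by rewrite augM augE mul0r.
Qed.

Definition grassmann : algType K := alg_quot grassmann_proper.

End Grassmann.

Lemma exists_functional (K : fieldType) (V : lmodType K) (v : V) : v != 0 ->
  exists f : {linear V -> K^o}, f v = 1.
Proof.
move=> v0.
pose P : set (set V) := fun W =>
  (forall a x y, W x -> W y -> W (a *: x + y)) /\ ~ W v.
have [F FP Ftot|W [[Wlin Wv] Wmax]] := @Zorn_bigcup V P.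
  split=> [a x y [X FX Xx] [Y FY Yy]|[X FX Xv]]; last exact: (FP _ FX).2.
  by have [XY|YX] := Ftot _ _ FX FY; [exists Y|exists X] => //;
     [apply: (FP _ FY).1 => //; exact: XY|apply: (FP _ FX).1 => //; exact: YX].
have W0 : W 0.
  apply: contrapT => W0; apply: (Wmax [set 0]%classic).
    split=> [x Wx|W0'].
      by case: W0; have := Wlin (-1) _ _ Wx Wx; rewrite scaleN1r addNr.
    by apply: W0; exact: W0'.
  split=> [a x y -> ->|v0']; first by rewrite scaler0 addr0.
  by rewrite v0' eqxx in v0.
have WZ a x : W x -> W (a *: x).
  by move=> Wx; rewrite -[_ *: _]addr0; exact: Wlin.
have WD x y : W x -> W y -> W (x + y).
  by move=> Wx Wy; rewrite -[x]scale1r; exact: Wlin.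
have ex x : exists c, W (x - c *: v).
  have [Wx|Wx] := pselect (W x); first by exists 0; rewrite scale0r subr0.
  pose W' : set V := fun y => exists w c, W w /\ y = w + c *: x.
  have W'v : W' v.
    apply: contrapT => W'v; apply: (Wmax W'); first split.
    - by move=> w Ww; exists w, 0; rewrite scale0r addr0.
    - move=> sub; apply/Wx/sub; exists 0, 1.
      by split=> //; rewrite scale1r add0r.
    split=> // a y z [w [c [Ww ->]]] [w' [c' [Ww' ->]]].
    exists (a *: w + w'), (a * c + c'); split; first exact: Wlin.
    by rewrite scalerDr scalerDl scalerA addrACA.
  have [w [c [Ww vE]]] := W'v.
  have c0 : c != 0.
    by apply/eqP => c0; apply: Wv; rewrite vE c0 scale0r addr0.
  exists c^-1; rewrite vE scalerDr scalerA mulVf // scale1r opprD addrCA subrr.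
  by rewrite addr0 -scaleNr; exact: WZ.
have uniq x c d : W (x - c *: v) -> W (x - d *: v) -> c = d.
  move=> Wc Wd; apply/eqP; rewrite -subr_eq0; apply/negP => /negP cd.
  apply: Wv; rewrite -[v]scale1r -(mulVf cd) -scalerA; apply: (WZ).
  have -> : (c - d) *: v = (x - d *: v) + (-1) *: (x - c *: v).
    by rewrite scaleN1r opprB scalerBl [RHS]addrC addrA subrK.
  exact: (WD _ _ Wd (WZ _ _ Wc)).
have [f fP] := choice ex.
have flin : linear (f : V -> K^o).
  move=> a x y; apply: (uniq (a *: x + y)); first exact: fP.
  have -> : a *: x + y - (a *: (f x : K^o) + f y) *: v =
            a *: (x - f x *: v) + (y - f y *: v).
    by rewrite scalerBr scalerDl opprD addrACA scalerA.
  by apply: Wlin; exact: fP.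
pose fL := GRing.isLinear.Build K V K^o *:%R f flin.
exists (HB.pack f fL : {linear V -> K^o}) => /=.
by apply: (uniq v); [exact: fP|rewrite scale1r subrr].
Qed.

Section Tensor.
Variables (K : fieldType) (A B : algType K).

Definition tens (a : A) (b : B) : free_alg K (A * B)%type := fgen K (a, b).
Local Notation "a \t b" := (tens a b) (at level 40).

(* The last two relations make the span of the symbols [a \t b] closed under
   products and contain 1, so that the algebra presented here is the space
   spanned by these symbols modulo bilinearity, that is A (x) B. *)
Inductive tensor_rel : free_alg K (A * B)%type -> Prop :=
| TensorDl a a' b : tensor_rel ((a + a') \t b - (a \t b + a' \t b))
| TensorDr a b b' : tensor_rel (a \t (b + b') - (a \t b + a \t b'))
| TensorZl c a b : tensor_rel ((c *: a) \t b - c *: (a \t b))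
| TensorZr c a b : tensor_rel (a \t (c *: b) - c *: (a \t b))
| TensorM a b a' b' : tensor_rel ((a \t b) * (a' \t b') - (a * a') \t (b * b'))
| Tensor1 : tensor_rel (1 \t 1 - 1).

Lemma tensor_proper : ~ ideal_gen tensor_rel 1.
Proof.
have [f f1] := exists_functional (oner_neq0 A).
have [g g1] := exists_functional (oner_neq0 B).
have fZ c a : f (c *: a) = c * f a by exact: linearZ.
have gZ c b : g (c *: b) = c * g b by exact: linearZ.
pose pA (m : {fmonom (A * B)%type}) : A := \prod_(x <- m) x.1.
pose pB (m : {fmonom (A * B)%type}) : B := \prod_(x <- m) x.2.
have pAM m n : pA (mmul m n) = pA m * pA n by rewrite /pA fmM big_cat.
have pBM m n : pB (mmul m n) = pB m * pB n by rewrite /pB fmM big_cat.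
have pA1 : pA mone = 1 by rewrite /pA fm1 big_nil.
have pB1 : pB mone = 1 by rewrite /pB fm1 big_nil.
have pAu x : pA (fmu x) = x.1 by rewrite /pA fmU big_seq1.
have pBu x : pB (fmu x) = x.2 by rewrite /pB fmU big_seq1.
have [phi [phiD phiZ phiU]] := malg_functional (fun m => f (pA m) * g (pB m)).
have {phiD} phiD (u v : free_alg K (A * B)%type) : phi (u + v) = phi u + phi v.
  exact: phiD.
have {phiZ} phiZ c (u : free_alg K (A * B)%type) : phi (c *: u) = c * phi u.
  exact: phiZ.
have phi0 : phi (0 : free_alg K (A * B)%type) = 0.
  by rewrite -(scale0r 0) phiZ mul0r.
have phiB (u v : free_alg K (A * B)%type) : phi (u - v) = phi u - phi v.
  by rewrite phiD -scaleN1r phiZ mulN1r.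
have UU k l : << k >> * << l >> = << mmul k l >> :> free_alg K (A * B)%type.
  by rewrite malgM_def fgmulUU mulr1.
pose S (u : free_alg K (A * B)%type) :=
  exists m : {fmonom (A * B)%type}, u = << m >>.
move=> /(@ideal_gen_functional _ _ _ S phi) H.
have {H} : phi (1 : free_alg K (A * B)%type) = 0; last first.
  by move/eqP; rewrite (phiU mone) pA1 pB1 f1 g1 mulr1 oner_eq0.
apply: H => // [P P0 PD PZ|_ r _ [m ->] Rr [n ->]].
  by apply: free_alg_ind => // c m; apply: PZ; exists m.
pose M : free_alg K (A * B)%type := << m >>.
pose N : free_alg K (A * B)%type := << n >>.
pose psi (u : free_alg K (A * B)%type) := phi (M * u * N).
have psiD u v : psi (u + v) = psi u + psi v.
  exact: etrans (congr1 phi (mulrDlr M N u v)) (phiD _ _).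
have psiB u v : psi (u - v) = psi u - psi v.
  exact: etrans (congr1 phi (mulrBlr M N u v)) (phiB _ _).
have psiZ c u : psi (c *: u) = c * psi u.
  exact: etrans (congr1 phi (mulrZlr c M N u)) (phiZ _ _).
have psiBD u v w : psi (u - (v + w)) = psi u - (psi v + psi w).
  by rewrite psiB psiD.
have psiBZ c u v : psi (u - c *: v) = psi u - c * psi v.
  by rewrite psiB psiZ.
have psiE a b : psi (a \t b) = f (pA m * a * pA n) * g (pB m * b * pB n).
  by rewrite /psi /M /N /tens /fgen !UU phiU !(pAM, pBM) pAu pBu.
have psiM a b a' b' : psi ((a \t b) * (a' \t b')) =
    f (pA m * (a * a') * pA n) * g (pB m * (b * b') * pB n).
  by rewrite /psi /M /N /tens /fgen !UU phiU !(pAM, pBM) !pAu !pBu.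
have psi1 : psi 1 = f (pA m * pA n) * g (pB m * pB n).
  by rewrite /psi /M /N mulr1 UU phiU pAM pBM.
change (psi r = 0); clearbody psi.
case: Rr => [a a' b|a b b'|c a b|c a b|a b a' b'|].
- by rewrite psiBD !psiE mulrDlr raddfD -mulrDl subrr.
- by rewrite psiBD !psiE mulrDlr raddfD -mulrDr subrr.
- by rewrite psiBZ !psiE mulrZlr fZ mulrA subrr.
- by rewrite psiBZ !psiE mulrZlr gZ mulrCA subrr.
- by rewrite psiB; apply/eqP; rewrite subr_eq0 [eqbLHS]psiM [eqbRHS]psiE.
- by rewrite psiB; apply/eqP; rewrite subr_eq0 [eqbLHS]psiE [eqbRHS]psi1 !mulr1.
Qed.

Definition tensor : algType K := alg_quot tensor_proper.

End Tensor.

(* Left-associated A (x) B (x) ... (x) B, with k factors B. *)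
Definition tensor_pow (K : fieldType) (A B : algType K) (k : nat) : algType K :=
  iter k (fun C => tensor C B) A.

(* [{malg K[nat]}] is the K-vector space of finitely supported functions
   nat -> K. *)
Definition grassmann_inf (K : fieldType) : algType K := grassmann {malg K[nat]}.
Definition grassmann_fin (K : fieldType) (r : nat) : algType K :=
  grassmann 'rV[K]_r.

Definition commutator (A : nzRingType) (u v : A) : A := u * v - v * u.

(* [x_1, ..., x_n] = [[x_1, ..., x_(n-1)], x_n] *)
Definition long_commutator (A : nzRingType) (s : seq A) : A :=
  foldl (@commutator A) (head 0 s) (behead s).

Definition satisfies_long_commutator (A : nzRingType) (n : nat) : Prop :=
  forall x : n.-tuple A, long_commutator x = 0.

(* Main.v *)
From HB Require Import structures.
Require Import Defs.
From mathcomp Require Import all_boot all_order all_algebra.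
From mathcomp Require Import monalg zify.

(* Write lcs n for the additive span of the commutators with n + 1 entries.

   Upper bound: if lcs m of A vanishes then so do the products (lcs i) (lcs j)
   with m < i + j.  If the commutators of B are central and have zero products,
   a commutator of n + 1 pure tensors is a sum of tensors w (x) b with w in lcs n
   and [d u, c_1, ..., c_s] (x) [b, b'] b'' with u in lcs i and i + s + 1 = n;
   by the Leibniz rule and the vanishing products both kinds are 0 when
   n = m + 2.  Hence each factor E_2 or E_3 raises the class by at most 2,
   starting from [x_1, x_2, x_3] = 0 in E.

   Lower bound: let e_0, e_1, ... be the generators of E and f, f' two generators
   of the finite factor.  With k factors, some commutator with 2k + 2 entries has
   the value c = 2^(2k+1) e_0 ... e_(2k+1) (x) f f' (x) ... (x) f f'.  Replacing
   x_1 by x_1 (x) f gives the value c (x) f with one more factor, and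
   [c (x) f, e (x) f', e' (x) 1] = 4 c e e' (x) f f' for the next two generators
   e, e' of E. *)

Set Implicit Arguments.
Unset Strict Implicit.
Unset Printing Implicit Defensive.

Import GRing.Theory.
Local Open Scope ring_scope.
Local Notation comm := (@commutator _).

(** * Commutator calculus and products of commutators in a Lie nilpotent ring *)

Section LowerCentralSeries.
Variable A : nzRingType.
Implicit Types (u v w x y : A) (s : seq A).

Lemma commutatorDl x : {morph comm^~ x : u v / u + v}.
Proof. by move=> u v; rewrite /commutator mulrDl mulrDr opprD addrACA. Qed.

Lemma commutatorDr x : {morph comm x : u v / u + v}.
Proof. by move=> u v; rewrite /commutator mulrDl mulrDr opprD addrACA. Qed.

Lemma commutator0 x : comm 0 x = 0.
Proof. by rewrite /commutator mul0r mulr0 subrr. Qed.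

Lemma commutator1 x : comm x 1 = 0.
Proof. by rewrite /commutator mul1r mulr1 subrr. Qed.

Lemma commutatorN x : {morph comm^~ x : u / - u}.
Proof. by move=> u; rewrite /commutator mulNr mulrN -opprD. Qed.

Lemma commutator_mull u v x : comm (u * v) x = u * comm v x + comm u x * v.
Proof. by rewrite /commutator mulrBr mulrBl !mulrA addrA subrK. Qed.

Lemma commutator_mulr u v x : comm u (v * x) = v * comm u x + comm u v * x.
Proof. by rewrite /commutator mulrBr mulrBl !mulrA [RHS]addrC addrA subrK. Qed.

(** The Jacobi identity, arranged so that a commutator in the second slot becomes a difference of
    left-normed ones. *)
Lemma commutator_jacobi u v x :
  comm u (comm v x) = comm (comm u v) x - comm (comm u x) v.
Proof.
have -> : comm (comm u v) x = comm (u * v) x - comm (v * u) x.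
  by rewrite -commutatorN -commutatorDl.
rewrite !commutator_mull; set c := comm v x; set d := comm u x.
by rewrite [_ + c * u]addrC opprD addrACA addrK.
Qed.

Lemma commutator_central u : (forall x, u * x = x * u) ->
  forall x, comm u x = 0.
Proof. by move=> cu x; rewrite /commutator cu subrr. Qed.

Lemma foldl_commutatorD s : {morph (fun u => foldl comm u s) : u v / u + v}.
Proof.
by elim: s => //= x s IHs u v; rewrite commutatorDl IHs.
Qed.

(* Commutators with [n.+1] entries, not [n]. *)
Inductive lcs (n : nat) : A -> Prop :=
| lcs_foldl x s : size s = n -> lcs n (foldl comm x s)
| lcs0 : lcs n 0
| lcsN u : lcs n u -> lcs n (- u)
| lcsD u v : lcs n u -> lcs n v -> lcs n (u + v).

Lemma lcs_all u : lcs 0 u.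
Proof. exact: (@lcs_foldl 0 u [::]). Qed.

Lemma lcsS n u x : lcs n u -> lcs n.+1 (comm u x).
Proof.
elim=> [y s sz||v _ IHv|v w _ IHv _ IHw].
- by rewrite -foldl_rcons; apply: lcs_foldl; rewrite size_rcons sz.
- by rewrite commutator0; exact: lcs0.
- by rewrite commutatorN; exact: lcsN.
- by rewrite commutatorDl; exact: lcsD.
Qed.

Lemma lcs_foldl_commutator n u s : lcs n u -> lcs (n + size s) (foldl comm u s).
Proof.
elim: s n u => [|x s IHs] n u nu /=; first by rewrite addn0.
by rewrite addnS -addSn; apply/IHs/lcsS.
Qed.

(** The first [n - m] commutations can be absorbed into the first entry. *)
Lemma lcs_le m n u : (m <= n)%N -> lcs n u -> lcs m u.
Proof.
move=> mn; elim=> [x s sz||v _ IHv|v w _ IHv _ IHw]; last 3 first.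
- exact: lcs0.
- exact: lcsN.
- exact: lcsD.
rewrite -(cat_take_drop (n - m) s) foldl_cat; apply: lcs_foldl.
by rewrite size_drop sz subKn.
Qed.

(** Induction on the length of [v]: Jacobi peels off its last entry and moves it to the outside or
    onto [u]. *)
Lemma lcs_commutator m n u v :
  lcs m u -> lcs n v -> lcs (m + n).+1 (comm u v).
Proof.
have commr0 x : comm x 0 = 0 by rewrite /commutator mul0r mulr0 subrr.
have commrN x y : comm x (- y) = - comm x y.
  by rewrite /commutator mulNr mulrN -opprD.
move=> mu nv; elim: nv u m mu => [x s <-||{}v _ IHv|{}v w _ IHv _ IHw] u m mu.
- elim/last_ind: s u m mu => [|s y IHs] u m mu.
    by rewrite addn0; exact: lcsS.
  rewrite foldl_rcons commutator_jacobi size_rcons addnS.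
  apply: lcsD; first exact/lcsS/IHs.
  by apply: lcsN; rewrite -addSn; apply/IHs/lcsS.
- by rewrite commr0; exact: lcs0.
- by rewrite commrN; apply/lcsN/IHv.
- by rewrite commutatorDr; apply: lcsD; [exact: IHv | exact: IHw].
Qed.

Definition lcs_mul0 m n := forall u v, lcs m u -> lcs n v -> u * v = 0.

(** In the Leibniz expansion the entries of [s] are shared out between [u] and [v]. A term giving
    [i > 0] of them to [u] is a product that the hypothesis kills; only the term giving all of them
    to [v] survives. *)
Lemma foldl_commutator_mul m n s u v :
    (forall i, (0 < i <= size s)%N -> lcs_mul0 (m + i) (n + (size s - i))) ->
    lcs m u -> lcs n v ->
  foldl comm (u * v) s = u * foldl comm v s.
Proof.
elim: s m n u v => //= x s IHs m n u v H mu nv.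
rewrite commutator_mull foldl_commutatorD (IHs m n.+1) ?(IHs m.+1 n) //.
- have ux_v0 : comm u x * foldl comm v s = 0.
    apply: (H 1%N); rewrite ?addn1 ?subn1 //=; first exact: lcsS.
    exact: lcs_foldl_commutator.
  by rewrite ux_v0 addr0.
- move=> i /andP[i0 Hi]; rewrite addSnnS; have /= := H i.+1; rewrite subSS.
  by apply.
- exact: lcsS.
- by move=> i /andP[i0 Hi]; rewrite addSnnS -subSn //; apply: H; lia.
- exact: lcsS.
Qed.

Lemma foldl_commutator_mul0 m n s u v :
    (forall i, (i <= size s)%N -> lcs_mul0 (m + i) (n + (size s - i))) ->
  lcs m u -> lcs n v -> foldl comm (u * v) s = 0.
Proof.
move=> H mu nv; rewrite (@foldl_commutator_mul m n) //; last first.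
  by move=> i /andP[_ ]; exact: H.
apply: (H 0%N) => //; first by rewrite addn0.
by rewrite subn0; exact: lcs_foldl_commutator.
Qed.

Definition lie_nilpotent m := forall u, lcs m u -> u = 0.

Lemma lie_nilpotentW m n u : lie_nilpotent m -> (m <= n)%N -> lcs n u -> u = 0.
Proof. by move=> Am mn nu; apply/Am/(lcs_le mn). Qed.

Lemma satisfies_long_commutatorP m :
  satisfies_long_commutator A m.+1 <-> lie_nilpotent m.
Proof.
split=> [Am u|Am x]; last first.
  rewrite /long_commutator; apply/Am/lcs_foldl.
  by rewrite size_behead size_tuple.
elim=> [x s sz||v _ ->|v w _ -> _ ->]; rewrite ?oppr0 ?addr0 //.
have sz1 : size (x :: s) == m.+1 by rewrite /= sz.
exact: (Am (Tuple sz1)).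
Qed.

(** Strong induction on [i]. The order of the two factors is immaterial throughout: exchanging them
    changes the product by an element of [lcs (i + j).+1], which is 0. *)
Lemma lcs_mul_eq0 m i j : lie_nilpotent m -> (m < i + j)%N -> lcs_mul0 i j.
Proof.
move=> Am; have [n] := ubnP i; elim: n => // n IHn in i j *.
rewrite ltnS leq_eqVlt => /predU1P[->|]; last exact: IHn.
have {}IHn i' j' : (i' < n)%N -> (m < i' + j')%N ->
    lcs_mul0 i' j' /\ lcs_mul0 j' i'.
  move=> i'n mij; split; first exact: IHn.
  move=> u v ju iv; have vu0 : v * u = 0 by exact: (IHn i' j').
  rewrite -[u * v]subr0 -[in LHS]vu0.
  by apply: (lie_nilpotentW Am _ (lcs_commutator ju iv)); lia.
move=> mnj u v nu jv.
have [n1|n1] := leqP n 1.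
  by rewrite (lie_nilpotentW Am _ jv) ?mulr0 //; lia.
have [j0|j0] := leqP j 0.
  by rewrite (lie_nilpotentW Am _ nu) ?mul0r //; lia.
suff {u v nu jv} H u v : lcs n u -> lcs j v -> v * u = 0.
  rewrite -[u * v]subr0 -[in LHS](H u v) //.
  by apply: (lie_nilpotentW Am _ (lcs_commutator nu jv)); lia.
move=> nu jv; elim: nu => [y s sz||{}u _ IHu|u1 u2 _ IH1 _ IH2]; last 3 first.
- by rewrite mulr0.
- by rewrite mulrN IHu oppr0.
- by rewrite mulrDr IH1 IH2 addr0.
elim: jv => [b t tz||{}v _ IHv|v1 v2 _ IH1 _ IH2]; last 3 first.
- by rewrite mul0r.
- by rewrite mulNr IHv oppr0.
- by rewrite mulrDl IH1 IH2 addr0.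
case: s sz => [|z s sz]; first by move=> /= E; rewrite -E in n1.
case/lastP: t tz => [|t d]; first by move=> /= E; rewrite -E in j0.
rewrite size_rcons => tz; rewrite foldl_rcons /=.
have {tz} tz : size t = j.-1 by rewrite -tz.
have {sz} sz : size s = n.-1 by rewrite -sz.
set x := comm y z; set w := foldl comm b t.
have x1 : lcs 1 x by apply/lcsS/lcs_all.
have wj : lcs j.-1 w by exact: lcs_foldl.
(* In the Leibniz expansion of [w, d x, s] = 0 the induction hypothesis kills
   everything but [w, d] [x, s]: as [x] is itself a commutator, the other terms
   have a first or second factor with fewer entries. *)
have : foldl comm (comm w (d * x)) s = 0.
  apply: (lie_nilpotentW Am _ (lcs_foldl_commutator s (lcsS _ wj))).
  by rewrite sz; lia.
rewrite commutator_mulr foldl_commutatorD.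
rewrite (@foldl_commutator_mul0 0 j.+1) ?add0r; first last.
- have := lcs_commutator wj x1; rewrite addn1 prednK //.
- exact: lcs_all.
- by move=> k Hk; rewrite add0n; apply: (IHn _ _ _ _).1; lia.
rewrite (@foldl_commutator_mul j 1) //; last first.
- by have := lcsS d wj; rewrite prednK.
- by move=> k Hk; apply: (IHn _ _ _ _).2; lia.
Qed.

End LowerCentralSeries.

(** * Words in the free algebra and a test for their survival in a quotient *)

Section FreeAlgebraQuotient.
Variables (K : fieldType) (X : choiceType).
Implicit Types (x : X) (s t w : seq X).

Definition word w : free_alg K X := \prod_(x <- w) fgen K x.

Lemma word_monom (m : {fmonom X}) : << m >> = word m :> free_alg K X.
Proof.
case: m => w /=; elim: w => [|x w IHw].
  by rewrite /word big_nil; congr << _ >>; apply: val_inj; rewrite [RHS]fm1.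
rewrite /word big_cons -/(word w) -IHw; symmetry.
rewrite [LHS]malgM_def fgmulUU mulr1; congr << _ >>.
by apply: val_inj; rewrite /= fmM fmU.
Qed.

Lemma free_alg_word_ind (P : free_alg K X -> Prop) :
    P 1 -> (forall u v, P u -> P v -> P (u + v)) ->
    (forall c u, P u -> P (c *: u)) ->
    (forall x u, P u -> P (fgen K x * u)) ->
  forall u, P u.
Proof.
move=> P1 PD PZ PM; apply: free_alg_ind => //.
  by rewrite -(scale0r 1); apply: PZ.
move=> c m; apply: PZ; rewrite word_monom /word.
by elim: (m : seq X) => [|x w IHw]; rewrite ?big_nil ?big_cons //; apply: PM.
Qed.

(** Extend [h] linearly from words to a functional [phi]. It vanishes on the ideal as soon as all
    its translates [u -> phi (word s * u * word t)] kill the relations; [psi] stands for such a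
    translate. *)
Lemma alg_quot_word_neq0 (R : free_alg K X -> Prop) (R1 : ~ ideal_gen R 1)
    (h : seq X -> K) w :
    (forall s t (psi : {linear free_alg K X -> K^o}),
       (forall w', psi (word w') = h (s ++ w' ++ t)) ->
     forall r, R r -> psi r = 0) ->
  h w != 0 -> alg_quot_pi R1 (word w) != 0.
Proof.
move=> hR; apply: contra_neq => w0.
have [phi [phiD phiZ phiU]] := malg_functional (fun m : {fmonom X} => h m).
have phiw w' : phi (word w') = h w'.
  have -> : word w' = << FMonom w' >> by rewrite word_monom.
  exact: phiU.
rewrite -phiw.
apply: (@ideal_gen_functional _ _ R (fun u => exists s, u = word s) phi).
- move=> P P0 PD PZ; apply: free_alg_ind => // c m; apply: PZ.
  by exists m; rewrite word_monom.
- exact: phiD.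
- exact: phiZ.
- move=> _ r _ [s ->] Rr [t ->].
  pose psi0 (u : free_alg K X) : K^o := phi (word s * u * word t).
  have psiL : linear psi0.
    move=> a u v; rewrite /psi0 mulrDlr [LHS]phiD; congr (_ + _).
    by rewrite mulrZlr [LHS]phiZ.
  pose psiM := GRing.isLinear.Build K (free_alg K X) K^o *:%R psi0 psiL.
  pose psi : {linear free_alg K X -> K^o} := HB.pack psi0 psiM.
  apply: (hR s t psi) => // w'.
  by rewrite -phiw /= /psi0 /word !big_cat /= mulrA.
- rewrite -[word w]subr0; apply/(alg_quot_pi_eq R1); rewrite w0.
  by apply: (addrI (alg_quot_pi R1 0)); rewrite -alg_quot_piD !addr0.
Qed.

End FreeAlgebraQuotient.

(** * Pure tensors, and the growth of the Lie nilpotency class under a tensor factor *)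

Section TensorProduct.
Variables (K : fieldType) (A B : algType K).
Local Notation T := (tensor A B).

Definition pten (a : A) (b : B) : T :=
  alg_quot_pi (@tensor_proper K A B) (tens a b).
Local Notation "a \t b" := (pten a b) (at level 40).

Local Notation "\p u" := (alg_quot_pi (@tensor_proper K A B) u) (at level 10).

Let piP u v : tensor_rel (u - v) -> \p u = \p v.
Proof.
move=> Ruv; apply/alg_quot_pi_eq; rewrite -[u - v]mul1r -[_ * _]mulr1.
exact: IdealM.
Qed.

Let piM u v : \p (u * v) = \p u * \p v.
Proof. by rewrite -alg_quot_piM. Qed.

Let piZ c u : \p (c *: u) = c *: \p u.
Proof. by rewrite -alg_quot_piZ. Qed.

Lemma ptenDl b : {morph pten^~ b : a a' / a + a'}.
Proof. by move=> a a'; rewrite /pten -alg_quot_piD; exact/piP/TensorDl. Qed.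

Lemma ptenDr a : {morph pten a : b b' / b + b'}.
Proof. by move=> b b'; rewrite /pten -alg_quot_piD; exact/piP/TensorDr. Qed.

Lemma ptenZl c a b : (c *: a) \t b = c *: (a \t b).
Proof. by rewrite /pten -piZ; exact/piP/TensorZl. Qed.

Lemma ptenZr c a b : a \t (c *: b) = c *: (a \t b).
Proof. by rewrite /pten -piZ; exact/piP/TensorZr. Qed.

Lemma ptenM a b a' b' : (a \t b) * (a' \t b') = (a * a') \t (b * b').
Proof. by rewrite /pten -piM; exact/piP/TensorM. Qed.

Lemma pten1 : 1 \t 1 = 1.
Proof. exact/piP/Tensor1. Qed.

Lemma pten0l b : 0 \t b = 0.
Proof. by rewrite -(scale0r 0) ptenZl scale0r. Qed.

Lemma pten0r a : a \t 0 = 0.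
Proof. by rewrite -(scale0r 0) ptenZr scale0r. Qed.

Lemma ptenNl a b : (- a) \t b = - (a \t b).
Proof. by rewrite -scaleN1r ptenZl scaleN1r. Qed.

Lemma ptenNr a b : a \t (- b) = - (a \t b).
Proof. by rewrite -scaleN1r ptenZr scaleN1r. Qed.

Lemma tensor_ind (P : T -> Prop) :
    (forall u v, P u -> P v -> P (u + v)) -> (forall a b, P (a \t b)) ->
  forall u, P u.
Proof.
move=> PD Pt; elim/alg_quot_ind.
(* A pure tensor carried along on the left absorbs the scalars and letters of [u] one by one. *)
suff H u a b : P (a \t b * \p u).
  by move=> u; rewrite -[\p u]mul1r -pten1.
move: a b; elim/free_alg_word_ind: u => [|u v IHu IHv|c u IHu|x u IHu] a b.
- by rewrite [\p 1]/(1 : T) mulr1.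
- by rewrite alg_quot_piD mulrDr; apply: PD.
- by rewrite piZ -scalerAr scalerAl -ptenZl.
- by case: x => a' b'; rewrite piM mulrA -[\p _]/(a' \t b') ptenM.
Qed.

(** If [f a = 1] and [g b = 1], the functional that multiplies out the two components of a word
    separately and then applies [f] and [g] respects the relations and takes the value 1 here. *)
Lemma pten_neq0 a b : a != 0 -> b != 0 -> a \t b != 0.
Proof.
move=> /exists_functional[f f1] /exists_functional[g g1].
pose pA (s : seq (A * B)) : A := \prod_(x <- s) x.1.
pose pB (s : seq (A * B)) : B := \prod_(x <- s) x.2.
rewrite /pten; have -> : tens a b = word K [:: (a, b)].
  by rewrite /word big_seq1.
pose h s : K := f (pA s) * g (pB s).
have fg1 : h [:: (a, b)] != 0.
  by rewrite /h /pA /pB !big_seq1 /= f1 g1 mulr1 oner_neq0.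
apply: (alg_quot_word_neq0 (@tensor_proper K A B) _ fg1).
move=> s t psi psiE r.
have fZ c x : f (c *: x) = c * f x by exact: linearZ.
have gZ c y : g (c *: y) = c * g y by exact: linearZ.
have psiZ c u : psi (c *: u) = c * psi u by exact: linearZ.
have psiT x y : psi (tens x y) = f (pA s * x * pA t) * g (pB s * y * pB t).
  have := psiE [:: (x, y)].
  by rewrite /h /= /pA /pB /word !big_cat !big_cons big_nil mulr1 /= !mulrA.
case=> [x x' y|x y y'|c x y|c x y|x y x' y'|].
- by rewrite raddfB raddfD /= !psiT mulrDlr raddfD mulrDl subrr.
- by rewrite raddfB raddfD /= !psiT mulrDlr raddfD mulrDr subrr.
- by rewrite raddfB /= psiZ !psiT mulrZlr fZ mulrA subrr.
- by rewrite raddfB /= psiZ !psiT mulrZlr gZ mulrCA subrr.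
- rewrite raddfB /= psiT; have := psiE [:: (x, y); (x', y')].
  rewrite /h /= /pA /pB /word !big_cat !big_cons big_nil /= mulr1 => ->.
  by rewrite !mulrA subrr.
- rewrite raddfB /= psiT; have := psiE [::].
  rewrite /h /= /pA /pB /word !big_cat big_nil !mulr1 => ->.
  by rewrite subrr.
Qed.

Lemma commutator_pten a b a' b' :
  comm (a \t b) (a' \t b') = comm a a' \t (b * b') + (a' * a) \t comm b b'.
Proof.
rewrite /commutator !ptenM ptenDl ptenDr ptenNl ptenNr addrA.
by rewrite subrK.
Qed.

Lemma foldl_commutator_pten1 a b s :
  foldl comm (a \t b) (map (pten^~ 1) s) = foldl comm a s \t b.
Proof.
elim: s a => //= y s IHs a.
by rewrite commutator_pten mulr1 commutator1 pten0r addr0 IHs.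
Qed.

Hypothesis commC : forall b b' c : B, comm b b' * c = c * comm b b'.
Hypothesis comm_mul0 : forall b b' c c' : B, comm b b' * comm c c' = 0.

(** In [tlcs_mixed] the successor counts the entry spent on [comm b b']; [d] is the left component
    of that entry, and [s] collects those of the later ones. *)
Inductive tlcs (n : nat) : T -> Prop :=
| tlcs_pure w b : lcs n w -> tlcs n (w \t b)
| tlcs_mixed i u d s b b' c : lcs i u -> (i + size s).+1 = n ->
    tlcs n (foldl comm (d * u) s \t (comm b b' * c))
| tlcs0 : tlcs n 0
| tlcsN x : tlcs n x -> tlcs n (- x)
| tlcsD x y : tlcs n x -> tlcs n y -> tlcs n (x + y).

(** A pure term gives a pure one and a mixed one with empty [s]. A mixed term gives a single mixed
    one, because its right component commutes with everything: [[b, b'] c, b''] = [b, b'] [c, b''] +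
    [b, b', b''] c = 0. *)
Lemma tlcsS n x y : tlcs n x -> tlcs n.+1 (comm x y).
Proof.
move=> nx; elim/tensor_ind: y => [y y' IHy IHy'|a' b'].
  by rewrite commutatorDr; exact: tlcsD.
elim: nx => [w b nw|i u d s b1 b2 c iu <-||{}x _ IHx|x1 x2 _ IH1 _ IH2].
- rewrite commutator_pten; apply: tlcsD; first exact/tlcs_pure/lcsS.
  rewrite -[comm b b']mulr1.
  by apply: (@tlcs_mixed n.+1 n w a' [::] b b' 1 nw); rewrite addn0.
- rewrite commutator_pten; set z := comm b1 b2 * c.
  have -> : comm z b' = 0.
    rewrite /z commutator_mull comm_mul0 add0r.
    by rewrite (commutator_central (commC b1 b2)) mul0r.
  rewrite pten0r addr0 -foldl_rcons -mulrA.
  by apply: (tlcs_mixed _ _ _ _ iu); rewrite size_rcons addnS.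
- by rewrite commutator0; exact: tlcs0.
- by rewrite commutatorN; exact: tlcsN.
- by rewrite commutatorDl; exact: tlcsD.
Qed.

Lemma lcs_tlcs n x : lcs n x -> tlcs n x.
Proof.
elim=> [{}x s <-||y _|y z _ IHy _ IHz]; last 3 first.
- exact: tlcs0.
- exact: tlcsN.
- exact: tlcsD.
elim/last_ind: s => [|s y IHs].
  elim/tensor_ind: x => [u v|a b]; first exact: tlcsD.
  exact/tlcs_pure/lcs_all.
by rewrite foldl_rcons size_rcons; exact: tlcsS.
Qed.

(** For a mixed term [i + size s] equals [m.+1], just enough for [lcs_mul_eq0] to kill each term of
    the Leibniz expansion. The entry spent in [B] and the strict inequality there account for the
    increase by 2. *)
Lemma lie_nilpotent_tensor m : lie_nilpotent A m -> lie_nilpotent T m.+2.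
Proof.
move=> Am x /lcs_tlcs.
elim=> [w b mw|i u d s b b' c iu sz||y _ ->|y z _ -> _ ->].
- by rewrite (lie_nilpotentW Am _ mw) ?pten0l // ltnW.
- rewrite (@foldl_commutator_mul0 _ 0 i) ?pten0l //; last exact: lcs_all.
  by move=> k kr; apply: (lcs_mul_eq0 Am); lia.
- by [].
- by rewrite oppr0.
- by rewrite addr0.
Qed.

End TensorProduct.

(** * Central elements *)

Definition central (R : nzRingType) (x : R) := forall y, x * y = y * x.

Section Central.
Variables (K : fieldType) (A : algType K).
Implicit Types x y : A.

Lemma centralD x y : central x -> central y -> central (x + y).
Proof. by move=> cx cy z; rewrite mulrDl mulrDr cx cy. Qed.

Lemma centralM x y : central x -> central y -> central (x * y).
Proof. by move=> cx cy z; rewrite -mulrA cy mulrA cx mulrA. Qed.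

Lemma central0 : central (0 : A).
Proof. by move=> z; rewrite mul0r mulr0. Qed.

Lemma central1 : central (1 : A).
Proof. by move=> z; rewrite mul1r mulr1. Qed.

Lemma centralZ c x : central x -> central (c *: x).
Proof. by move=> cx z; rewrite -scalerAl -scalerAr cx. Qed.

End Central.

(** * Algebras generated by a linear space of elements of square zero *)

Section AnticommutingGenerators.
Variables (K : fieldType) (V : lmodType K) (G : algType K).
Variable g : {linear V -> G}.
Implicit Types (u v w : V) (x y p q : G).

Hypothesis g_sq : forall v, g v * g v = 0.
Hypothesis g_ind : forall P : G -> Prop,
  P 1 -> (forall x y, P x -> P y -> P (x + y)) ->
  (forall c x, P x -> P (c *: x)) -> (forall v x, P x -> P (g v * x)) ->
  forall x, P x.

(** Polarisation of [g_sq] at [v + w]. *)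
Lemma anticommutingC v w : g v * g w = - (g w * g v).
Proof.
have := g_sq (v + w); rewrite raddfD mulrDl !mulrDr !g_sq add0r addr0.
by move/eqP; rewrite addr_eq0 => /eqP.
Qed.

Lemma central_gen x : (forall v, x * g v = g v * x) -> central x.
Proof.
move=> xv y; elim/g_ind: y => [|y z IHy IHz|c y IHy|v y IHy].
- by rewrite mulr1 mul1r.
- by rewrite mulrDr mulrDl IHy IHz.
- by rewrite -scalerAr IHy scalerAl.
- by rewrite mulrA xv -!mulrA IHy.
Qed.

Lemma central_gen2 v w : central (g v * g w).
Proof.
apply: central_gen => u.
rewrite -mulrA (anticommutingC w u) mulrN.
by rewrite [RHS]mulrA (anticommutingC u v) mulNr mulrA.
Qed.

Inductive add_span (S : G -> Prop) : G -> Prop :=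
| add_span_gen x : S x -> add_span S x
| add_span0 : add_span S 0
| add_spanD x y : add_span S x -> add_span S y -> add_span S (x + y).

(** Central coefficients take the place of even ones, so that no grading has to be constructed. *)
Definition odd_gen x := exists2 p, central p & exists v, x = p * g v.
Definition even2_gen x :=
  exists2 p, central p & exists v w, x = p * (g v * g w).

(** Left multiplication by a generator exchanges the two summands, products of two generators being
    central. *)
Lemma central_odd_decomp x :
  exists p q, [/\ central p, add_span odd_gen q & x = p + q].
Proof.
elim/g_ind: x => [|x y [p [q [cp oq ->]]] [p' [q' [cp' oq' ->]]]
  |c x [p [q [cp oq ->]]]|v x [p [q [cp oq ->]]]].
- exists 1, 0; split; [exact: central1 | exact: add_span0 | by rewrite addr0].
- exists (p + p'), (q + q'); split; [exact: centralD | exact: add_spanD |].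
  by rewrite addrACA.
- exists (c *: p), (c *: q); split; [exact: centralZ | | exact: scalerDr].
  elim: oq => [_ [r cr [v ->]]||y z _ IHy _ IHz]; last 2 first.
  + by rewrite scaler0; exact: add_span0.
  + by rewrite scalerDr; exact: add_spanD.
  apply: add_span_gen; exists (c *: r); first exact: centralZ.
  by exists v; rewrite scalerAl.
- exists (g v * q), (g v * p); split; last by rewrite mulrDr addrC.
  + elim: oq => [_ [r cr [w ->]]||y z _ IHy _ IHz]; last 2 first.
    * by rewrite mulr0; exact: central0.
    * by rewrite mulrDr; exact: centralD.
    rewrite mulrA -cr -mulrA; apply: centralM => //; exact: central_gen2.
  + by apply: add_span_gen; exists p => //; exists v; rewrite cp.
Qed.

(** Central summands drop out of the commutator, and two odd terms give [r g(v), r' g(v')] = 2 r r'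
    g(v) g(v') by anticommutation. *)
Lemma commutator_even2 x y : add_span even2_gen (comm x y).
Proof.
have commC0 p z : central p -> comm z p = 0.
  by move=> cp; rewrite /commutator cp subrr.
have [p [q [cp oq ->]]] := central_odd_decomp x.
have [p' [q' [cp' oq' ->]]] := central_odd_decomp y.
rewrite commutatorDl (commutator_central cp) add0r commutatorDr.
rewrite (commC0 p') // add0r.
elim: oq => [_ [r cr [v ->]]||{x p cp}u w _ IHu _ IHw]; last 2 first.
- by rewrite commutator0; exact: add_span0.
- by rewrite commutatorDl; exact: add_spanD.
elim: oq' => [_ [r' cr' [v' ->]]||u w _ IHu _ IHw]; last 2 first.
- by rewrite commC0; [exact: add_span0 | exact: central0].
- by rewrite commutatorDr; exact: add_spanD.
apply: add_span_gen; exists (r * r' + r * r').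
  by apply: centralD; exact: centralM.
exists v, v'; rewrite /commutator.
have cM (s t a b : G) : central t -> (s * a) * (t * b) = s * t * (a * b).
  by move=> ct; rewrite -mulrA [a * _]mulrA -ct !mulrA.
rewrite (cM r r') // (cM r' r) // -(cr r') (anticommutingC v' v).
by rewrite mulrN opprK mulrDl.
Qed.

Lemma anticommuting_commutatorC x y z : comm x y * z = z * comm x y.
Proof.
elim: (commutator_even2 x y) => [_ [p cp [v [w ->]]]||u w _ IHu _ IHw].
- apply: centralM => //; exact: central_gen2.
- exact: central0.
- by rewrite mulrDl mulrDr IHu IHw.
Qed.

Lemma anticommuting_lie_nilpotent : lie_nilpotent G 2.
Proof.
move=> x; elim=> [u s sz||{}x _ ->|{}x y _ -> _ ->]; last 3 first.
- by [].
- by rewrite oppr0.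
- by rewrite addr0.
case: s sz => [|v [|w []]] //= _.
exact/commutator_central/anticommuting_commutatorC.
Qed.

(** Each commutator contributes two generators with a central coefficient, so every term of the
    product contains four generators in a row. *)
Lemma anticommuting_commutator_mul0 :
    (forall t u v w, g t * g u * (g v * g w) = 0) ->
  forall x y x' y', comm x y * comm x' y' = 0.
Proof.
move=> g4 x y x' y'.
elim: (commutator_even2 x y) => [_ [p cp [t [u ->]]]||z z' _ IH _ IH'];
  last 2 first.
- by rewrite mul0r.
- by rewrite mulrDl IH IH' addr0.
elim: (commutator_even2 x' y') => [_ [p' cp' [v [w ->]]]||z z' _ IH _ IH'];
  last 2 first.
- by rewrite mulr0.
- by rewrite mulrDr IH IH' addr0.
by rewrite cp' mulrA -(mulrA p) g4 mulr0 mul0r.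
Qed.

End AnticommutingGenerators.

(** * The Grassmann algebra: generators, induction, and nonzero products *)

Section GrassmannAlgebra.
Variables (K : fieldType) (V : lmodType K).
Local Notation G := (grassmann V).
Local Notation "\p u" := (alg_quot_pi (@grassmann_proper K V) u) (at level 10).

Let piP (u v : free_alg K V) : grassmann_rel (u - v) -> \p u = \p v.
Proof.
move=> Ruv; apply/alg_quot_pi_eq; rewrite -[u - v]mul1r -[_ * _]mulr1.
exact: IdealM.
Qed.

Let piM (u v : free_alg K V) : \p (u * v) = \p u * \p v.
Proof. by rewrite -alg_quot_piM. Qed.

Let piZ c (u : free_alg K V) : \p (c *: u) = c *: \p u.
Proof. by rewrite -alg_quot_piZ. Qed.

Let pi0 : \p 0 = 0.
Proof. by apply: (addrI (\p 0)); rewrite -alg_quot_piD !addr0. Qed.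

Definition ggen (v : V) : G := \p (fgen K v).

Fact ggen_linear : linear ggen.
Proof.
move=> c v w; rewrite /ggen -piZ -alg_quot_piD.
transitivity (\p (fgen K (c *: v) + fgen K w)); first exact/piP/GrassmannD.
rewrite [LHS]alg_quot_piD [RHS]alg_quot_piD; congr (_ + _).
exact/piP/GrassmannZ.
Qed.

HB.instance Definition _ :=
  GRing.isLinear.Build K V G *:%R ggen ggen_linear.

Lemma ggen_sq v : ggen v * ggen v = 0.
Proof.
by rewrite /ggen -piM -pi0; apply: piP; rewrite subr0; exact: GrassmannSq.
Qed.

Lemma grassmann_ind (P : G -> Prop) :
    P 1 -> (forall x y, P x -> P y -> P (x + y)) ->
    (forall c x, P x -> P (c *: x)) ->
    (forall v x, P x -> P (ggen v * x)) ->
  forall x, P x.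
Proof.
move=> P1 PD PZ PM; elim/alg_quot_ind.
elim/free_alg_word_ind=> [|u v IHu IHv|c u IHu|v u IHu] //.
- by rewrite alg_quot_piD; exact: PD.
- by rewrite piZ; exact: PZ.
- by rewrite piM; exact: PM.
Qed.

(* On words of length [size ws] the determinant of the matrix of coordinates is
   a functional compatible with the Grassmann relations. *)
Lemma grassmann_prod_neq0 (l : nat -> {linear V -> K^o}) (ws : seq V) :
    (forall i j, (i < size ws)%N -> (j < size ws)%N ->
       l j (nth 0 ws i) = (i == j)%:R) ->
  \prod_(v <- ws) ggen v != 0.
Proof.
set n := size ws => lw.
pose M s : 'M[K]_n := \matrix_(i, j) l j (nth 0 s i).
pose h s : K := if size s == n then \det (M s) else 0.
have -> : \prod_(v <- ws) ggen v = \p (word K ws).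
  rewrite /word; elim: (ws) => [|v s IHs]; first by rewrite !big_nil.
  by rewrite !big_cons piM IHs.
have hw : h ws != 0.
  rewrite /h eqxx [M ws](_ : _ = 1%:M) ?det1 ?oner_neq0 //.
  by apply/matrixP=> i j; rewrite !mxE lw ?ltn_ord.
apply: (alg_quot_word_neq0 (@grassmann_proper K V) _ hw).
move=> s t psi psiE r.
have psi1 v : psi (fgen K v) = h (s ++ v :: t).
  by rewrite -[fgen K v]/(_ v) -(psiE [:: v]) /word big_seq1.
(* The matrices differ only in the row of index [size s], in which the determinant is linear; words
   of another length have value 0. *)
have hZD a v w : h (s ++ (a *: v + w) :: t) =
    a * h (s ++ v :: t) + h (s ++ w :: t).
  rewrite /h !size_cat /=.
  have [st|_] := eqVneq; last by rewrite mulr0 addr0.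
  have sn : (size s < n)%N by rewrite -st addnS ltnS leq_addr.
  rewrite -[\det (M (s ++ w :: t))]mul1r.
  have row'E u u' : row' (Ordinal sn) (M (s ++ u :: t)) =
      row' (Ordinal sn) (M (s ++ u' :: t)).
    apply/matrixP=> i j; rewrite !mxE; congr (l j _); rewrite !nth_cat.
    have := neq_lift (Ordinal sn) i; rewrite -val_eqE /=.
    by case: ltngtP => // lti _; rewrite -(subnSK lti).
  apply: (@determinant_multilinear _ _ _ _ _ (Ordinal sn)) => //.
  apply/rowP=> j; rewrite !mxE /= !nth_cat ltnn subnn /= linearD linearZ /=.
  by rewrite mul1r.
case=> [v w|c v|v].
- by rewrite raddfB raddfD /= !psi1 -[v]scale1r hZD scale1r mul1r subrr.
- have := hZD c v 0; rewrite addr0.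
  (* This instance says that the value at a word with letter 0 is twice itself, hence 0. *)
  have := hZD 1 0 0; rewrite scale1r addr0 mul1r.
  move/eqP; rewrite -subr_eq0 opprD addrA subrr sub0r oppr_eq0 => /eqP -> hZ.
  by rewrite raddfB /= [psi (_ *: _)]linearZ /= !psi1 hZ addr0 subrr.
- have <- : word K [:: v; v] = fgen K v * fgen K v.
    by rewrite /word !big_cons big_nil mulr1.
  rewrite psiE /h; have [st|//] := eqVneq.
  have sn : ((size s).+1 < n)%N by rewrite -st !size_cat /=; lia.
  (* The repeated letter [v] makes two consecutive rows equal. *)
  apply: (@determinant_alternate _ _ _ (Ordinal (ltnW sn)) (Ordinal sn)).
    by rewrite -val_eqE /= neq_ltn ltnSn.
  move=> j; rewrite !mxE /= !nth_cat ltnn subnn ltnNge leqnSn /= subSnn.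
  by [].
Qed.

End GrassmannAlgebra.

(** * Products of four generators in rank at most 3 *)

Lemma row_ind (K : fieldType) (r : nat) (P : 'rV[K]_r -> Prop) :
    P 0 -> (forall u v, P u -> P v -> P (u + v)) ->
    (forall c v, P v -> P (c *: v)) -> (forall i, P (delta_mx 0 i)) ->
  forall v, P v.
Proof.
move=> P0 PD PZ Pdelta v; rewrite [v]row_sum_delta.
by apply: (big_ind P) => // i _; exact/PZ/Pdelta.
Qed.

Section AnticommutingFin.
Variables (K : fieldType) (r : nat) (G : algType K).
Variable g : {linear 'rV[K]_r -> G}.
Hypothesis g_sq : forall v, g v * g v = 0.

(** By multilinearity the four vectors may be taken from the basis. Two of them then coincide, and
    anticommutation brings these together to form a square. *)
Lemma anticommuting_prod4_eq0 : (r <= 3)%N ->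
  forall t u v w, g t * g u * (g v * g w) = 0.
Proof.
move=> r3 t u v w.
have gC := anticommutingC g_sq.
have aba a b c : g a * g b * (g a * g c) = 0.
  by rewrite mulrA -(mulrA (g a)) (gC b a) mulrN mulrA g_sq mul0r oppr0 mul0r.
elim/row_ind: t => [|t t' IH IH'|c t IH|i].
- by rewrite raddf0 !mul0r.
- by rewrite raddfD !mulrDl IH IH' addr0.
- by rewrite linearZ -!scalerAl IH scaler0.
elim/row_ind: u => [|u u' IH IH'|c u IH|j].
- by rewrite raddf0 mulr0 mul0r.
- by rewrite raddfD mulrDr mulrDl IH IH' addr0.
- by rewrite linearZ -scalerAr -scalerAl IH scaler0.
elim/row_ind: v => [|v v' IH IH'|c v IH|k].
- by rewrite raddf0 mul0r mulr0.
- by rewrite raddfD mulrDl mulrDr IH IH' addr0.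
- by rewrite linearZ -scalerAl -scalerAr IH scaler0.
elim/row_ind: w => [|w w' IH IH'|c w IH|l].
- by rewrite raddf0 !mulr0.
- by rewrite raddfD !mulrDr IH IH' addr0.
- by rewrite linearZ -!scalerAr IH scaler0.
have [<-|ij] := eqVneq i j; first by rewrite g_sq mul0r.
have [<-|kl] := eqVneq k l; first by rewrite g_sq mulr0.
have [<-|ik] := eqVneq i k; first exact: aba.
have [<-|il] := eqVneq i l; first by rewrite (gC 'e_k) mulrN aba oppr0.
have [<-|jk] := eqVneq j k.
  by rewrite mulrA -(mulrA (g 'e_i)) g_sq mulr0 mul0r.
have [<-|jl] := eqVneq j l.
  by rewrite (gC 'e_i) (gC 'e_k) mulrN mulNr aba !oppr0.
have ijkl : uniq [:: i; j; k; l] by rewrite /= !inE !negb_or ij ik il jk jl kl.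
have := max_card (mem [:: i; j; k; l]).
by rewrite (card_uniqP ijkl) card_ord leqNgt ltnS r3.
Qed.

End AnticommutingFin.

(** * The lower bound: an explicit nonzero commutator *)

Section PureTensors.
Variables (K : fieldType) (A B : algType K).

Fixpoint tpure k (a : A) (b : B) : tensor_pow A B k :=
  if k is k'.+1 then pten (tpure k' a b) b else a.

Lemma tpureM k a b a' b' :
  tpure k a b * tpure k a' b' = tpure k (a * a') (b * b').
Proof. by elim: k => //= k IHk; rewrite [LHS]ptenM IHk. Qed.

Lemma tpureZ k c a b : tpure k (c *: a) b = c *: tpure k a b.
Proof. by elim: k => //= k ->; rewrite [LHS]ptenZl. Qed.

Lemma tpureD k b : {morph (fun a => tpure k a b) : a a' / a + a'}.
Proof. by elim: k => //= k IHk a a'; rewrite IHk [LHS]ptenDl. Qed.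

Lemma tpure_neq0 k a b : a != 0 -> b != 0 -> tpure k a b != 0.
Proof. by move=> a0 b0; elim: k => //= k IHk; exact: pten_neq0. Qed.

Lemma commutator_tpure1 k a b a' :
  comm (tpure k a b) (tpure k a' 1) = tpure k (comm a a') b.
Proof.
rewrite /commutator !tpureM mulr1 mul1r tpureD.
by rewrite -[- (a' * a)]scaleN1r tpureZ scaleN1r.
Qed.

(** As [c] and [y] commute, only the commutator of [f] and [f'] survives from the first step; the
    right component 1 confines the second step to [T]. *)
Lemma foldl_commutator_pten2 (T : algType K) (c y y' : T) (f f' : B) :
    comm c y = 0 ->
  foldl comm (pten c f) [:: pten y f'; pten y' 1] =
    pten (comm (y * c) y') (comm f f').
Proof.
move=> cy; rewrite /= commutator_pten cy pten0l add0r commutator_pten.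
by rewrite commutator1 pten0r addr0 mulr1.
Qed.

Variables (e : nat -> A) (f f' : B).
Hypothesis eC : forall i j, e i * e j = - (e j * e i).
Hypothesis eeC : forall i j, central (e i * e j).
Hypothesis fC : f' * f = - (f * f').

Lemma central_prod_even k : central (\prod_(0 <= i < k.*2) e i).
Proof.
elim: k => [|k IHk]; first by rewrite big_nil; exact: central1.
rewrite doubleS !big_nat_recr //= -mulrA; exact: centralM.
Qed.

Lemma long_commutator_tensor_pow k : exists x s, size s = k.*2.+1 /\
  foldl comm x s =
    tpure k (2 ^+ k.*2.+1 *: \prod_(0 <= i < k.+1.*2) e i) (f * f').
Proof.
have ff' : comm f f' = 2 *: (f * f').
  by rewrite /commutator fC opprK scaler_nat mulr2n.
elim: k => [|k [x [s [sz xs]]]].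
  exists (e 0%N), [:: e 1%N]; split=> //=.
  rewrite !big_nat_recr //= big_nil mul1r expr1 scaler_nat mulr2n.
  by rewrite /commutator (eC 1%N) opprK.
set P := (X in tpure k (_ *: X)) in xs.
have cP : central P by exact: central_prod_even.
set C := _ *: P in xs.
have cC : central C by exact: centralZ.
(* The product [P] uses the generators of index below [k.+1.*2]; these are the next two. *)
pose y := tpure k (e k.+1.*2) 1; pose y' := tpure k (e k.+1.*2.+1) 1.
exists (pten x f : tensor_pow A B k.+1).
exists (map (@pten K (tensor_pow A B k) B ^~ 1) s ++ [:: pten y f'; pten y' 1]).
split; first by rewrite size_cat size_map sz addn2.
rewrite foldl_cat [foldl _ _ (map _ _)]foldl_commutator_pten1 xs.
rewrite [LHS]foldl_commutator_pten2; last first.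
  rewrite commutator_tpure1 commutator_central //.
  by rewrite -(scale0r 0) tpureZ scale0r.
rewrite tpureM mul1r commutator_tpure1 ff' ptenZr -ptenZl -tpureZ.
congr (pten (tpure k _ _) _).
(* The central [C] comes out of the commutator. One new factor 2 came from [comm f f'], the other
   comes from the commutator of the two new generators. *)
rewrite -cC commutator_mull (commutator_central cC) mul0r addr0.
rewrite (doubleS k.+1) big_nat_recr // big_nat_recr // -/P (doubleS k).
rewrite /commutator (eC k.+1.*2.+1) opprK -mulr2n -scaler_nat.
by rewrite -scalerAr /C -!scalerAl !scalerA -[2 * 2 * _]mulrA -!exprS mulrA.
Qed.

Lemma not_lie_nilpotent_tensor_pow k : 2 != 0 :> K -> f * f' != 0 ->
    \prod_(0 <= i < k.+1.*2) e i != 0 ->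
  ~ lie_nilpotent (tensor_pow A B k) k.*2.+1.
Proof.
move=> two0 ff0 P0; have [x [s [sz xs]]] := long_commutator_tensor_pow k.
move=> /(_ _ (lcs_foldl x sz)) /eqP; apply/negP; rewrite xs tpure_neq0 //.
by rewrite scaler_eq0 negb_or expf_neq0.
Qed.

End PureTensors.

(** * Application to the infinite and finite Grassmann algebras *)

Section Conclusion.
Variable K : fieldType.

Fact mcoeff_linear j : linear (mcoeff j : {malg K[nat]} -> K^o).
Proof. by move=> c u v; rewrite mcoeffD mcoeffZ. Qed.

Fact row_coord_linear n (j : 'I_n) : linear (fun v : 'rV[K]_n => v 0 j : K^o).
Proof. by move=> c u v; rewrite !mxE. Qed.

Lemma grassmann_lie_nilpotent (V : lmodType K) : lie_nilpotent (grassmann V) 2.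
Proof.
exact: (@anticommuting_lie_nilpotent K V _ (@ggen K V) (@ggen_sq K V)
  (@grassmann_ind K V)).
Qed.

Lemma lie_nilpotent_grassmann_tensor_pow r k : (r <= 3)%N ->
  lie_nilpotent (tensor_pow (grassmann_inf K) (grassmann_fin K r) k) k.*2.+2.
Proof.
move=> r3; elim: k => [|k IHk]; first exact: grassmann_lie_nilpotent.
apply: lie_nilpotent_tensor IHk.
- exact: (@anticommuting_commutatorC K _ _ (@ggen K _) (@ggen_sq K _)
    (@grassmann_ind K _)).
- apply: (@anticommuting_commutator_mul0 K _ _ (@ggen K _) (@ggen_sq K _)
    (@grassmann_ind K _)).
  exact: (anticommuting_prod4_eq0 (@ggen_sq K _) r3).
Qed.

Lemma not_lie_nilpotent_grassmann_tensor_pow r k : 2 != 0 :> K ->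
  ~ lie_nilpotent (tensor_pow (grassmann_inf K) (grassmann_fin K r.+2) k)
      k.*2.+1.
Proof.
move=> two0; pose e (i : nat) : grassmann_inf K := ggen << i >>.
pose f (i : 'I_r.+2) : grassmann_fin K r.+2 := ggen (delta_mx 0 i).
apply: (@not_lie_nilpotent_tensor_pow K _ _ e (f 0) (f 1)).
- by move=> i j; apply: (anticommutingC (@ggen_sq K _)).
- move=> i j; apply: (@central_gen2 K _ _ (@ggen K _) (@ggen_sq K _)
    (@grassmann_ind K _)).
- exact: (anticommutingC (@ggen_sq K _)).
- exact: two0.
(* Coordinate forms dual to the basis vectors; only the indices 0 and 1 are evaluated, where [inord]
   is faithful. *)
- pose c (j : nat) (v : 'rV[K]_r.+2) : K^o := v 0 (inord j).
  pose cL j := GRing.isLinear.Build K _ K^o *:%R (c j) (row_coord_linear _).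
  pose l j : {linear 'rV[K]_r.+2 -> K^o} := HB.pack (c j) (cL j).
  have := @grassmann_prod_neq0 K _ l [:: delta_mx 0 0; delta_mx 0 1].
  rewrite !big_cons big_nil mulr1; apply.
  move=> [|[|//]] [|[|//]] _ _; by rewrite /= /c mxE eqxx -val_eqE /= inordK.
(* The coefficient forms are dual to the basis of elements [<< i >>]. *)
- pose cL j := GRing.isLinear.Build K _ K^o *:%R (@mcoeff _ _ j)
    (mcoeff_linear j).
  pose l j : {linear {malg K[nat]} -> K^o} := HB.pack (@mcoeff _ _ j) (cL j).
  have := @grassmann_prod_neq0 K _ l [seq << i >> | i <- iota 0 k.+1.*2].
  rewrite big_map size_map size_iota /index_iota subn0; apply.
  move=> i j ik jk; rewrite (nth_map 0%N) ?size_iota // nth_iota //=.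
  exact: mcoeffU.
Qed.

End Conclusion.

Theorem corollary2p11 (K : fieldType) (k : nat) (hk : (1 <= k)%N) :
  (2%N \notin [pchar K]%R -> 3%N \notin [pchar K]%R ->
     satisfies_long_commutator
       (tensor_pow (grassmann_inf K) (grassmann_fin K 2) k) (2 * k + 3)%N /\
     satisfies_long_commutator
       (tensor_pow (grassmann_inf K) (grassmann_fin K 3) k) (2 * k + 3)%N) /\
  (2%N \notin [pchar K]%R ->
     ~ satisfies_long_commutator
         (tensor_pow (grassmann_inf K) (grassmann_fin K 2) k) (2 * k + 2)%N /\
     ~ satisfies_long_commutator
         (tensor_pow (grassmann_inf K) (grassmann_fin K 3) k) (2 * k + 2)%N).
Proof.
rewrite mul2n addn2 addn3; split=> [_ _|/= two0].
  by split; apply/satisfies_long_commutatorP/lie_nilpotent_grassmann_tensor_pow.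
(* Since 2 is prime, its absence from [[pchar K]] amounts to this. *)
have {}two0 : 2 != 0 :> K by [].
by split=> /satisfies_long_commutatorP;
  exact: not_lie_nilpotent_grassmann_tensor_pow.
Qed.
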